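(* Let $D\in\{2,3,4,6\}$, let $A$ be a rational number and $K$ a nonzero integer, and let $(v_n)_{n\ge0}$ be a sequence with $v_0,v_1\in\mathbb{Z}$ satisfying $(Dn+1)v_{n+1}=Anv_n-K(Dn-1)v_{n-1}$ for all $n\ge1$. Define $d_D(n)=\operatorname{lcm}(Dj+1)_{1\le j\le n}$ and $d_D^*(n)=d_D(n)/\prod_{p\in\mathcal{P}_n}p$, where $\mathcal{P}_n=\emptyset$ if $D=2$, and otherwise $\mathcal{P}_n$ is the set of primes $p$ with $\sqrt{2Dn}<p\le n$, $p\equiv-1\pmod D$, $p\ne D-1$, $p\nmid n+1$, $\{(n+1-1/D)/p\}\ge1/D$ and $\{(n+1/D)/p\}<1-1/D$. Then for every $n\ge1$: (i) If $A/K\in\mathbb{Z}$, then $d_D^*(n)K^{-\lfloor(n+1)/2\rfloor}v_{n+1}\in\mathbb{Z}$. (ii) More generally, let $g$ be the denominator of $A/K$, and assume that all prime divisors of $g$ divide $D$, that $v_2(K)\ge2v_2(g)-2$, and that $v_p(K)\ge2v_p(g)-1$ for primes $p\ge3$. Then there exist arithmetic functions $e_p(n)$ (for primes $p\mid g$) with $e_p(n)=O(\log n)$ such that $\prod_{p\mid g}p^{e_p(n)}\,d_D^*(n)K^{-\lfloor(n+1)/2\rfloor}v_{n+1}\in\mathbb{Z}$.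
   Context: $\{x\}=x-\lfloor x\rfloor$ is the fractional part; $v_p$ is the $p$-adic valuation. The paper writes the recurrence equivalently as $(n+B)v_{n+1}=Znv_n+K(B-n)v_{n-1}$ with $B=1/D$, $Z=A/D$. *)

(* Defs.v *)
From mathcomp Require Import all_boot all_order all_algebra.
From mathcomp Require Import all_classical all_reals all_analysis.

Set Implicit Arguments.
Unset Strict Implicit.
Unset Printing Implicit Defensive.

Import Order.TTheory GRing.Theory Num.Theory.

Local Open Scope ring_scope.

Definition frac_part (x : rat) : rat := x - (Num.floor x)%:~R.

Definition dD (D n : nat) : nat :=
  \big[lcmn/1%N]_(1 <= j < n.+1) (D * j + 1)%N.

(* Membership in P_n. The square root is taken in R; since 0 < D in all uses,
   [p = D.-1 %[mod D]] says that p is congruent to -1 modulo D. *)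
Definition excluded_prime (R : realType) (D n p : nat) : bool :=
  (D != 2%N) &&
  [&& prime p,
      Num.sqrt ((2 * D * n)%N%:R : R) < p%:R,
      (p <= n)%N,
      (p == D.-1 %[mod D])%N,
      p != D.-1,
      ~~ (p %| n.+1)%N,
      D%:R^-1 <= frac_part ((n%:R + 1 - D%:R^-1) / p%:R)
    & frac_part ((n%:R + D%:R^-1) / p%:R) < 1 - D%:R^-1].

(* This is a quotient in rat; integrality is not assumed. *)
Definition dD_star (R : realType) (D n : nat) : rat :=
  (dD D n)%:R / \prod_(p < n.+1 | excluded_prime R D n p) p%:R.

(* Main.v *)
Require Import Defs.
From HB Require Import structures.
From mathcomp Require Import all_boot all_order all_algebra.
From mathcomp Require Import all_classical all_reals all_analysis.
From mathcomp Require Import ring lra zify.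

(* Integrality is checked one prime [p] at a time. Put [B = 1/D], [a = A/K] and
   [Q = 1 - (A/D) x + K x^2]. The generating function of [v] satisfies a first
   order linear differential equation, whence
     v_(n+1) = v_0 r_(n+1)
       + sum_(k <= n) r_(n-k) ((1 - D) v_0 q_(k+1) + v_1 q_k) / (D k + 1),
   where [r_i] and [q_i] are the coefficients of [Q^(B-1)] and [Q^(-B)]. If [p]
   does not divide [D], both are [K^ceil(i/2)] times a [p]-integer, so only the
   factors [1/(D k + 1)] matter and [d_D(n)] removes them. If [p] is in [P_n],
   put [t = (p+1)/D]: then [Q^(B-1) = Q^(t-1) Q^(-B)(x^p)] mod [p], so [r_i]
   vanishes mod [p] when [i mod p >= 2t - 1], and the conditions on fractional
   parts say that this holds for [i = n - k] whenever [p] divides [D k + 1].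
   If [p] divides [D] but not [g], the recurrence itself is [p]-integral.
   If [p] divides [g], expand [v] in powers of [T = x/(1 + K x^2)]: with
   [V = sum_k a_k T^k] for [A = 0], the general solution is
     sum_(k,s) a_k A^s T^(k+s) prod_(j<s) (k+j)/(D(k+j)+1).
   The last product is divisible by [s!] in the [p]-integers, and [v_p(s!)] is
   [s/(p-1)] up to [O(log s)], which makes up for the denominator
   of [a^s K^(s/2)], as [p] is 2 or 3. *)

Set Implicit Arguments.
Unset Strict Implicit.
Unset Printing Implicit Defensive.

Import Order.TTheory GRing.Theory Num.Theory.
Import numFieldNormedType.Exports.

Local Open Scope classical_set_scope.
Local Open Scope ring_scope.

(** * Rational numbers with denominator prime to p *)

(** The localization of the integers at [p]; a test on the reduced denominator makes it a predicate
    that can be registered as a subring. *)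
Definition local_int (p : nat) : {pred rat} := fun x => coprime p `|denq x|.

(** Numerator and denominator being coprime, the reduced denominator divides every [m] that clears
    [x], so any such [m] prime to [p] is a witness. *)
Lemma local_intP (p : nat) (x : rat) :
  reflect (exists2 m : nat, coprime p m & m%:R * x \is a Num.int)
          (x \in local_int p).
Proof.
apply: (iffP idP) => [px|[m pm /intrP[z mxz]]].
  exists `|denq x|%N => //.
  by rewrite natr_absz normr_denq mulrC -numqE intr_int.
have dvd_m : (`|denq x| %| m)%N.
  have := coprime_num_den x; rewrite coprime_sym => /Gauss_dvdr <-.
  rewrite -[X in (_ %| _ * X)%N]/(`|m%:Z|%N) -abszM.
  apply/dvdnP; exists `|z|%N; rewrite -abszM; congr absz.
  apply: (@intr_inj rat); rewrite !intrM numqE -mxz.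
  by rewrite -pmulrn mulrC mulrA.
by rewrite unfold_in; apply: coprime_dvdr dvd_m pm.
Qed.

Lemma local_int_subring (p : nat) : subring_closed (local_int p).
Proof.
split=> [|x y|x y]; first by rewrite unfold_in coprimen1.
all: move=> /local_intP[m pm mx] /local_intP[k pk ky].
all: apply/local_intP; exists (m * k)%N; rewrite ?coprimeMr ?pm // natrM.
  have -> : m%:R * k%:R * (x - y) = k%:R * (m%:R * x) - m%:R * (k%:R * y) by ring.
  by rewrite rpredB // rpredM ?natr_int.
by rewrite mulrACA rpredM.
Qed.

HB.instance Definition _ p :=
  GRing.isSubringClosed.Build rat (local_int p) (local_int_subring p).

Lemma int_of_local (x : rat) :
  (forall p : nat, prime p -> x \in local_int p) -> x \is a Num.int.
Proof.
move=> px; rewrite Qint_def; apply: contraT => dx.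
have d1 : `|denq x|%N != 1%N.
  by apply: contraNneq dx => d1; rewrite -normr_denq -abszE d1.
have [p pp pd] : exists2 p, prime p & (p %| `|denq x|)%N.
  exists (pdiv `|denq x|); rewrite ?pdiv_dvd // pdiv_prime //.
  by have := denq_neq0 x; rewrite -absz_gt0; move: d1; case: absz => [|[]].
by have := px p pp; rewrite unfold_in prime_coprime // pd.
Qed.

Lemma local_int_int (p : nat) (x : rat) : x \is a Num.int -> x \in local_int p.
Proof. exact: rpred_int_num. Qed.

Lemma local_int_natV (p m : nat) : coprime p m -> m%:R^-1 \in local_int p.
Proof.
move=> pm; apply/local_intP; exists m => //.
(* Coprimality allows [m = 0] when [p = 1]; the inverse is then 0 by convention. *)
by have [->|m0] := eqVneq (m%:R : rat) 0; rewrite ?mul0r ?divff // rpred0.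
Qed.

(** * Generalized binomial coefficients *)

(** Inverting the denominator modulo [p ^ M] by Bezout replaces a [p]-integer by a natural number,
    for which binomial congruences are classical. *)
Lemma local_int_approx (p M : nat) (z : rat) : prime p -> z \in local_int p ->
  exists e : nat, (z - e%:R) / p%:R ^+ M \in local_int p.
Proof.
move=> pp /local_intP[m pm /intrP[k mz]].
have pM0 : (p ^ M)%:Z != 0 by rewrite -lt0n expn_gt0 prime_gt0.
have pMr : (p%:R ^+ M : rat) != 0 by rewrite expf_neq0 // pnatr_eq0 -lt0n prime_gt0.
have [u [w uw]] : exists u w : int, u * m%:Z + w * (p ^ M)%:Z = 1.
  have /coprimezP[[u w] /= uw] : coprimez m%:Z (p ^ M)%:Z.
    by rewrite coprimezE /= coprime_sym coprimeXl.
  by exists u, w.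
pose e := `|((k * u) %% (p ^ M)%:Z)%Z|%N; exists e.
have eE : e%:Z = k * u - ((k * u) %/ (p ^ M)%:Z)%Z * (p ^ M)%:Z.
  by rewrite /e gez0_abs ?modz_ge0 // {2}(divz_eq (k * u) (p ^ M)%:Z) addrC addrK.
apply/local_intP; exists m => //; apply/intrP.
exists (k * w + m%:Z * ((k * u) %/ (p ^ M)%:Z)%Z).
rewrite mulrA mulrBr mz; apply: (canLR (mulfK pMr)).
rewrite -[m%:R]/(m%:Z%:~R) -[e%:R]/(e%:Z%:~R) eE.
rewrite -natrX -[(p ^ M)%:R]/((p ^ M)%:Z%:~R) -!intrM -intrB; congr _%:~R.
set q := divz _ _; set P := (p ^ M)%:Z in uw *.
apply: subr0_eq; transitivity (k * (1 - (u * m%:Z + w * P))); first by ring.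
by rewrite uw subrr mulr0.
Qed.

Definition gbin (z : rat) (m : nat) : rat :=
  (\prod_(l < m) (z - l%:R)) / m`!%:R.

Lemma gbin0 (z : rat) : gbin z 0 = 1.
Proof. by rewrite /gbin big_ord0 divr1. Qed.

Lemma mul_gbin_left (z : rat) (m : nat) :
  m.+1%:R * gbin z m.+1 = (z - m%:R) * gbin z m.
Proof.
rewrite /gbin big_ord_recr /= factS natrM invfM.
by field; rewrite nat1r !pnatr_eq0 -lt0n fact_gt0.
Qed.

Lemma gbin_nat (e m : nat) : gbin e%:R m = 'C(e, m)%:R.
Proof.
elim: m => [|m IHm]; first by rewrite gbin0 bin0.
have m0 : (m.+1%:R : rat) != 0 by rewrite pnatr_eq0.
apply: (mulfI m0); rewrite mul_gbin_left IHm -natrM mul_bin_left natrM.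
by have [em|me] := leqP m e; [rewrite natrB | rewrite bin_small ?mulr0].
Qed.

Lemma gbin_approx (p : nat) (z : rat) (m : nat) :
  prime p -> z \in local_int p ->
  exists2 e : nat, (z - e%:R) / p%:R \in local_int p
    & (gbin z m - 'C(e, m)%:R) / p%:R \in local_int p.
Proof.
move=> pp pz; have pr0 : (p%:R : rat) != 0 by rewrite pnatr_eq0 -lt0n prime_gt0.
(* The exponent exceeds the valuation of the factorial of [m] by one, so that a factor [p] survives
   division by this factorial. *)
have [e pe] := local_int_approx (logn p m`!).+1 pp pz; exists e.
  have -> : (z - e%:R) / p%:R =
    (z - e%:R) / p%:R ^+ (logn p m`!).+1 * p%:R ^+ logn p m`!.
    by rewrite exprS; field; rewrite pr0 expf_neq0.
  by rewrite rpredM // rpredX // rpred_nat.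
rewrite -gbin_nat /gbin -mulrBl.
set q := p%:R ^+ _ in pe.
have dP : (\prod_(l < m) (z - l%:R) - \prod_(l < m) (e%:R - l%:R)) / q
    \in local_int p.
  elim: (m in X in X \in _) => [|k IHk]; first by rewrite !big_ord0 subrr mul0r rpred0.
  rewrite !big_ord_recr /=.
  set X := \prod_(l < k) _ in IHk *; set Y := \prod_(l < k) _ in IHk *.
  have -> : (X * (z - k%:R) - Y * (e%:R - k%:R)) / q =
    (X - Y) / q * (z - k%:R) + Y * ((z - e%:R) / q) by ring.
  rewrite rpredD // rpredM ?rpredB ?rpred_nat //.
  by rewrite /Y rpred_prod // => l _; rewrite rpredB ?rpred_nat.
have [u pu mE] := pfactor_coprime pp (fact_gt0 m).
rewrite mE natrM natrX.
set Z := _ - _ in dP *.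
have u0 : (u%:R : rat) != 0.
  rewrite pnatr_eq0; apply: contraTneq (fact_gt0 m) => u0.
  by rewrite mE u0.
have -> : Z / (u%:R * p%:R ^+ logn p m`!) / p%:R = Z / q * u%:R^-1.
  by rewrite /q exprS; field; rewrite pr0 u0 expf_neq0.
by rewrite rpredM // local_int_natV.
Qed.

Lemma gbin_local_int (p : nat) (z : rat) (m : nat) :
  prime p -> z \in local_int p -> gbin z m \in local_int p.
Proof.
move=> pp pz; have [e _ he] := gbin_approx m pp pz.
have pr0 : (p%:R : rat) != 0 by rewrite pnatr_eq0 -lt0n prime_gt0.
have -> : gbin z m = (gbin z m - 'C(e, m)%:R) / p%:R * p%:R + 'C(e, m)%:R.
  by rewrite divfK // subrK.
by rewrite rpredD ?(rpredM he) ?rpred_nat.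
Qed.

(* The case of Lucas' theorem where the last base-[p] digits already force
   the binomial coefficient to vanish. *)
Lemma dvdn_bin_modn_lt (p m j : nat) :
  prime p -> (m %% p < j %% p)%N -> (p %| 'C(m, j))%N.
Proof.
move=> pp; elim: m j => [|m IHm] [|j]; rewrite ?mod0n ?bin0n //.
move=> mj.
have pj : ~~ (p %| j.+1)%N by rewrite /dvdn -lt0n; apply: leq_ltn_trans mj.
(* Absorption: [(m+1) C(m,j) = (j+1) C(m+1,j+1)] with [j+1] prime to [p]. Either [p] divides [m+1],
   or both residues drop by one and induction applies. *)
have := mul_bin_diag m.+1 j; rewrite /= => binE.
suff: (p %| j.+1 * 'C(m.+1, j.+1))%N by rewrite Euclid_dvdM // (negPf pj).
rewrite -binE Euclid_dvdM //; have [//|pm] := boolP (p %| m.+1)%N.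
apply/orP; right; apply: IHm.
have p0 := prime_gt0 pp.
have modS k : ~~ (p %| k.+1)%N -> (k.+1 %% p = (k %% p).+1)%N.
  move=> pk; rewrite -addn1 -modnDml addn1 modn_small //.
  rewrite ltn_neqAle ltn_pmod // andbT; apply: contra pk => /eqP kp.
  by rewrite /dvdn -addn1 -modnDml addn1 kp modnn.
by rewrite -ltnS -(modS m pm) -(modS j pj).
Qed.

(** * The convolution formula *)

(** Power series identities are handled as polynomial identities with an explicit multiple of ['X^N]
    as error. *)
Lemma eq_modXn (N : nat) (p q : {poly rat}) :
  (forall i : nat, (i < N)%N -> p`_i = q`_i) ->
  exists e : {poly rat}, p = q + 'X^N * e.
Proof.
move=> pq; exists (drop_poly N (p - q)).
rewrite -[p in LHS](subrK q) addrC -{1}(poly_take_drop N (p - q)).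
rewrite [_ * 'X^N]mulrC addrA; congr (_ + _).
rewrite -[RHS]addr0; congr (_ + _); apply/polyP => i.
by rewrite coef_take_poly coef0; case: ifP => // iN; rewrite coefB pq ?subrr.
Qed.

Lemma coef_deriv_natl (p : {poly rat}) (i : nat) :
  p^`()`_i = i.+1%:R * p`_i.+1.
Proof. by rewrite coef_deriv mulr_natl. Qed.

(* [(1 + X)^z] modulo [X^N]. *)
Definition binpoly (N : nat) (z : rat) : {poly rat} := \poly_(m < N) gbin z m.

(** The differential equation of [(1 + X)^z] fails for its truncation only at the cut-off degree,
    which leaves one monomial. *)
Lemma binpoly_deriv (N : nat) (z : rat) :
  (1 + 'X) * (binpoly N.+1 z)^`() =
  z%:P * binpoly N.+1 z - ((z - N%:R) * gbin z N)%:P * 'X^N.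
Proof.
apply/polyP => i; rewrite mulrDl mul1r coefD coefXM !coef_deriv_natl.
rewrite coefB !coefCM coefXn !coef_poly.
have := mul_gbin_left z i.
have [iN|Ni|->] := ltngtP i N.
- rewrite ltnS iN (ltn_trans iN) // => ->.
  case: i iN => [|i] iN /=; first by ring.
  by rewrite ltnS (ltnW iN); ring.
- case: i Ni => [|i] Ni //= _.
  have -> : (i.+2 < N.+1)%N = false by lia.
  have -> : (i.+1 < N.+1)%N = false by lia.
  by ring.
- rewrite ltnn ltnSn /= => _.
  by case: (N) => [|M] /=; rewrite ?ltnSn; ring.
Qed.

(** By the two differential equations, the product has a derivative divisible by ['X^N]; in
    characteristic 0 its coefficients 1 to [N] then vanish. *)
Lemma binpoly_mul (N : nat) (a b : rat) : a + b = -1 ->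
  exists e : {poly rat},
    (1 + 'X) * binpoly N.+1 a * binpoly N.+1 b = 1 + 'X^(N.+1) * e.
Proof.
move=> ab; apply: eq_modXn => i iN.
set P := (1 + 'X) * _ * _.
have [E PE] : exists E : {poly rat}, P^`() = 'X^N * E.
  exists (- (((a - N%:R) * gbin a N)%:P * binpoly N.+1 b
             + ((b - N%:R) * gbin b N)%:P * binpoly N.+1 a)).
  rewrite /P !derivM derivD derivX -polyC1 derivC add0r polyC1 mul1r.
  set F := binpoly _ a; set G := binpoly _ b.
  have -> : (F + (1 + 'X) * F^`()) * G + (1 + 'X) * F * G^`() =
     F * G + (1 + 'X) * F^`() * G + F * ((1 + 'X) * G^`()) by ring.
  rewrite !binpoly_deriv -/F -/G.
  have -> : b%:P = - 1 - a%:P :> {poly rat}.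
    by rewrite -polyC1 -polyCN -polyCB -ab addrC addKr.
  by ring.
case: i iN => [|i] iN.
  rewrite coef1 eqxx -horner_coef0 /P !hornerE !horner_coef0 !coef_poly /=.
  by rewrite !gbin0 !mulr1.
have := congr1 (fun p : {poly rat} => p`_i) PE.
rewrite coef_deriv coefXnM -ltnS iN => /eqP.
by rewrite mulrn_eq0 /= => /eqP ->; rewrite coef1.
Qed.

(** Chain rule; as [U] has no constant term, the error stays a multiple of ['X^N] after
    substitution. *)
Lemma comp_binpoly_deriv (N : nat) (z : rat) (W : {poly rat}) :
  let U := 'X * W in let F := binpoly N.+1 z \Po U in
  exists e : {poly rat}, (1 + U) * F^`() = z%:P * U^`() * F + 'X^N * e.
Proof.
move=> U F; exists (- ((z - N%:R) * gbin z N)%:P * W ^+ N * U^`()).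
rewrite /F deriv_comp mulrA.
have -> : (1 + U) * ((binpoly N.+1 z)^`() \Po U) =
  ((1 + 'X) * (binpoly N.+1 z)^`()) \Po U.
  by rewrite comp_polyM comp_polyD comp_polyX -polyC1 comp_polyC.
rewrite binpoly_deriv comp_polyB !comp_polyM !comp_polyC comp_Xn_poly /U exprMn.
by ring.
Qed.

Lemma comp_binpoly_mul (N : nat) (a b : rat) (W : {poly rat}) : a + b = -1 ->
  let U := 'X * W in exists e : {poly rat},
  (1 + U) * (binpoly N.+1 a \Po U) * (binpoly N.+1 b \Po U) = 1 + 'X^(N.+1) * e.
Proof.
move=> ab U; have [e E] := binpoly_mul N ab.
exists (W ^+ N.+1 * (e \Po U)).
have := congr1 (fun p => p \Po U) E.
rewrite /= !comp_polyM !comp_polyD comp_polyM comp_polyX -polyC1 comp_polyC => ->.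
by rewrite comp_Xn_poly /U exprMn mulrA.
Qed.

(** Variation of constants: writing [V = R * C] with [R = (1 + U)^(1/D - 1)] reduces the
    differential equation of [V] to [D x C' - (D - 1) C = ((1 - D) v_0 + v_1 x) (1 + U)^(-1/D)],
    which is solved one coefficient at a time. *)
Lemma conv_formula (D : nat) (A K : rat) (v : nat -> rat) (N : nat) :
  (1 < D)%N ->
  (forall n : nat, (1 <= n)%N ->
     (D%:R * n%:R + 1) * v n.+1 =
     A * n%:R * v n - K * (D%:R * n%:R - 1) * v n.-1) ->
  let U := 'X * (K *: 'X - (A / D%:R)%:P) in
  let r := fun i => (binpoly N.+1 (D%:R^-1 - 1) \Po U)`_i in
  let q := fun i => (binpoly N.+1 (- D%:R^-1) \Po U)`_i in
  forall n : nat, (n < N)%N ->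
    v n.+1 = r n.+1 * v 0%N +
      \sum_(k < n.+1) r (n - k)%N *
        (((1 - D%:R) * v 0%N * q k.+1 + v 1%N * q k) / (D%:R * k%:R + 1)).
Proof.
move=> D1 vrec U r q.
have D0 : (D%:R : rat) != 0 by rewrite pnatr_eq0; case: (D) D1.
have den0 k : (D%:R * k%:R + 1 : rat) != 0 by rewrite -natrM natr1 pnatr_eq0.
pose W := K *: 'X - (A / D%:R)%:P : {poly rat}.
have [E1 hR] := comp_binpoly_deriv N (D%:R^-1 - 1) W.
have [E2 hRq] := @comp_binpoly_mul N (D%:R^-1 - 1) (- D%:R^-1) W ltac:(ring).
rewrite -/U in hR hRq; rewrite /= in hR hRq.
pose R := binpoly N.+1 (D%:R^-1 - 1) \Po U.
pose q' := binpoly N.+1 (- D%:R^-1) \Po U.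
rewrite -/R -/q' in hR hRq.
have qE k : q'`_k = q k by [].
have U0 : U.[0] = 0 by rewrite hornerM hornerX mul0r.
have coef0F z : (binpoly N.+1 z \Po U)`_0 = 1.
  by rewrite -horner_coef0 horner_comp U0 horner_coef0 coef_poly gbin0.
(* At index [k+1] the left side multiplies the coefficient by [D(k+1) - (D-1) = D k + 1]; at index 0
   the factor [1 - D] cancels. *)
pose c k := if k is k.+1 then
  ((1 - D%:R) * v 0%N * q k.+1 + v 1%N * q k) / (D%:R * k%:R + 1) else v 0%N.
pose C := \poly_(k < N.+1) c k.
have [E3 hC] : exists e : {poly rat}, D%:R%:P * ('X * C^`()) - (D%:R - 1)%:P * C =
    (((1 - D%:R) * v 0%N)%:P + (v 1%N)%:P * 'X) * q' + 'X^(N.+1) * e.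
  apply: eq_modXn => k kN.
  rewrite mulrDl -mulrA coefB coefD !coefCM !coefXM.
  case: k kN => [|k] kN /=; first by rewrite coef_poly /= coef0F; ring.
  rewrite coef_deriv_natl coef_poly kN /= !qE -natr1.
  by field; rewrite den0.
pose V := R * C.
have [E hV] : exists e : {poly rat}, D%:R%:P * ((1 + U) * ('X * V^`())) =
   (D%:R - 1)%:P * ((1 - K%:P * 'X^2) * V) +
   (((1 - D%:R) * v 0%N)%:P + (v 1%N)%:P * 'X) + 'X^(N.+1) * e.
  have XU : 'X * U^`() = - (A / D%:R)%:P * 'X + (2 * K)%:P * 'X^2.
    rewrite /U derivM derivX derivB derivC derivZ derivX subr0 -!mul_polyC.
    by rewrite polyCM; ring.
  exists (D%:R%:P * E1 * C
    + (((1 - D%:R) * v 0%N)%:P + (v 1%N)%:P * 'X) * E2 + (1 + U) * R * E3).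
  have -> : D%:R%:P * ((1 + U) * ('X * V^`())) =
    D%:R%:P * 'X * ((1 + U) * R^`()) * C + (1 + U) * R * (D%:R%:P * ('X * C^`())).
    by rewrite /V derivM; ring.
  have -> : D%:R%:P * ('X * C^`()) = (D%:R - 1)%:P * C +
    ((((1 - D%:R) * v 0%N)%:P + (v 1%N)%:P * 'X) * q' + 'X^(N.+1) * E3).
    by rewrite -hC; ring.
  rewrite hR.
  have -> : forall x y : {poly rat}, (1 + U) * R * (y + (x * q' + 'X^(N.+1) * E3)) =
    (1 + U) * R * y + x * ((1 + U) * R * q') + (1 + U) * R * ('X^(N.+1) * E3).
    by move=> x y; ring.
  rewrite hRq /V.
  have -> : forall y : {poly rat},
    D%:R%:P * 'X * ((D%:R^-1 - 1)%:P * U^`() * R + y) * C =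
    (D%:R * (D%:R^-1 - 1))%:P * ('X * U^`()) * R * C + D%:R%:P * 'X * y * C.
    by move=> y; rewrite [(_ * (_ - _))%:P]polyCM; ring.
  rewrite XU mulrBr divff // mulr1 !polyCB [(2 * K)%:P]polyCM.
  have -> : 2%:P = 2 :> {poly rat} by rewrite polyC_natr.
  have -> : 1%:P = 1 :> {poly rat} by [].
  by rewrite (exprS 'X N) /U -mul_polyC; set XN := 'X^N; ring.
have coefVrec i : (i <= N)%N ->
    D%:R * (i%:R * V`_i - (if i is j.+1 then A / D%:R * (j%:R * V`_j) else 0)
     + (if i is j.+2 then K * (j%:R * V`_j) else 0)) =
    (D%:R - 1) * (V`_i - (if i is j.+2 then K * V`_j else 0))
    + (if i is 0 then (1 - D%:R) * v 0%N else if i is 1 then v 1%N else 0).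
  move=> iN; have := congr1 (fun p : {poly rat} => p`_i) hV.
  have -> : (1 + U) * ('X * V^`()) = 'X * V^`()
     - (A / D%:R)%:P * ('X * ('X * V^`())) + K%:P * ('X^2 * ('X * V^`())).
    by rewrite /U -mul_polyC; ring.
  have -> : (1 - K%:P * 'X^2) * V = V - K%:P * ('X^2 * V) by ring.
  rewrite /= !(coefD, coefN, coefCM) coefC !coefXM !coefXnM (ltnS i N) iN addr0.
  set w := A / D%:R.
  case: i iN => [|[|j]] iN /=; rewrite ?coefX ?coefXM /=.
  - by move=> e; lra.
  - by rewrite coef_deriv_natl => e; lra.
  - rewrite ?coefXM /= subn2 /= !coef_deriv_natl.
    by case: j iN => [|j] iN; rewrite /= ?coef_deriv_natl => e; lra.
(* The coefficients of [V] obey the recurrence of [v] and share its two initial values. *)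
have coefV i : (i <= N)%N -> V`_i = v i.
  elim/ltn_ind: i => -[|[|n]] IH iN.
  - by rewrite coefM big_ord1 coef_poly /= coef0F mul1r.
  - by have := coefVrec 1%N iN; set w := A / D%:R => /= e; lra.
  have := coefVrec n.+2 iN; have := vrec n.+1 isT.
  rewrite /= (IH n.+1) ?(IH n) ?(ltnW (ltnW iN)) ?(ltnW iN) //=.
  move=> e1 e2; apply: (mulfI (den0 n.+1)); rewrite e1.
  have e3 : D%:R * (A / D%:R) = A by rewrite mulrC divfK.
  set w := A / D%:R in e2 e3.
  rewrite -e3 -[n.+1%:R]natr1; rewrite -[n.+2%:R]natr1 -[n.+1%:R]natr1 in e2.
  by lra.
move=> n nN.
rewrite -coefV // coefM big_ord_recr /= subnn addrC coef_poly /=; congr (_ + _).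
rewrite (reindex_inj rev_ord_inj); apply: eq_bigr => -[k kn] _ /=.
have -> : (n.+1 - (n.+1 - k.+1) = k.+1)%N by lia.
by rewrite subSS coef_poly ltnS (leq_trans _ nN).
Qed.

(** * Primes not dividing D *)

Lemma coef_XsubC_exp (c : rat) (m j : nat) :
  (('X - c%:P) ^+ m)`_j = 'C(m, j)%:R * (- c) ^+ (m - j).
Proof.
rewrite -polyCN addrC exprDn coef_sum.
under eq_bigr => i _ do
  rewrite coefMn -polyC_exp coefCM coefXn.
have [jm|mj] := leqP j m; last first.
  rewrite bin_small // mul0r big1 // => -[i im] _ /=.
  have -> : (j == i) = false by lia.
  by rewrite mulr0 mul0rn.
rewrite (bigD1 (Ordinal (jm : (j < m.+1)%N))) //= eqxx mulr1 big1 => [|i].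
  by rewrite addr0 mulr_natl.
by rewrite -val_eqE /= eq_sym => /negPf ->; rewrite mulr0 mul0rn.
Qed.

Lemma local_int_div_le (p e f : nat) (K : int) (x : rat) : K != 0 -> (f <= e)%N ->
  x / K%:~R ^+ e \in local_int p -> x / K%:~R ^+ f \in local_int p.
Proof.
move=> K0; have Kr : (K%:~R : rat) != 0 by rewrite intr_eq0.
move=> fe xe; have -> : x / K%:~R ^+ f = x / K%:~R ^+ e * K%:~R ^+ (e - f).
  by rewrite -{1}(subnKC fe) exprD; field; rewrite !expf_neq0.
by rewrite rpredM // rpredX // rpred_int.
Qed.

(** For [A = K a] and [c = a/D], the polynomial [U] is [K X (X - c)], so [U^m] contributes the full
    power [K^m]. *)
Lemma coef_comp_binpoly (N : nat) (z K c : rat) (i : nat) :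
  (binpoly N z \Po ('X * (K *: 'X - (K * c)%:P)))`_i =
  \sum_(m < N) (if (m <= i)%N then
    gbin z m * 'C(m, i - m)%:R * K ^+ m * (- c) ^+ (m - (i - m)) else 0).
Proof.
have -> : 'X * (K *: 'X - (K * c)%:P) = K *: ('X * ('X - c%:P)).
  by rewrite polyCM mul_polyC -scalerBr -scalerAr.
rewrite /binpoly poly_def rmorph_sum /= coef_sum; apply: eq_bigr => m _.
rewrite comp_polyZ comp_Xn_poly exprZn exprMn !coefZ coefXnM coef_XsubC_exp.
by rewrite ltnNge; case: leqP => _ /=; rewrite ?mulr0 //; ring.
Qed.

Lemma coef_comp_binpoly_local (p N : nat) (z c d : rat) (K : int) (i : nat) :
  K != 0 -> c \in local_int p ->
  (forall m : nat, (m <= i)%N ->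
     gbin z m * 'C(m, i - m)%:R * d \in local_int p) ->
  (binpoly N z \Po ('X * (K%:~R *: 'X - (K%:~R * c)%:P)))`_i
    / K%:~R ^+ uphalf i * d \in local_int p.
Proof.
move=> K0 pc hd; rewrite coef_comp_binpoly !mulr_suml rpred_sum // => m _.
case: leqP => mi; last by rewrite !mul0r rpred0.
(* [U^m] has degree at most [2m], so only [m] with [2m >= i] contribute, and these carry at least
   [K^(uphalf i)]. *)
have [mC|Cm] := ltnP m (i - m).
  by rewrite bin_small // mulr0 !mul0r rpred0.
set g := gbin z m * _.
set x := _ ^+ (m - _).
have -> : g * K%:~R ^+ m * x / K%:~R ^+ uphalf i * d =
  g * d * x * (K%:~R ^+ m / K%:~R ^+ uphalf i) by ring.
apply: rpredM; first by apply: rpredM; [exact: hd | rewrite rpredX // rpredN].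
apply: (@local_int_div_le p m) => //; first by rewrite uphalfE -divn2; lia.
by rewrite divff ?rpred1 // expf_neq0 // intr_eq0.
Qed.

Lemma local_int_divp (p : nat) (z : int) :
  prime p -> z%:~R / p%:R \in local_int p -> (p%:Z %| z)%Z.
Proof.
move=> pp /local_intP[m pm /intrP[k]].
have p0 : (p%:R : rat) != 0 by rewrite pnatr_eq0 -lt0n prime_gt0.
rewrite mulrA => /(canRL (divfK p0)) mz.
have : (p%:Z %| m%:Z * z)%Z.
  by apply/dvdzP; exists k; apply: (@intr_inj rat); rewrite !intrM -mz.
by rewrite Gauss_dvdzr // coprimezE.
Qed.

(* With [t = (p + 1) / D], [(1 + U)^(1/D - 1)] is congruent to
   [(1 + U)^(t - 1)] times a series in [p]-th powers; for [U] of degree 2 the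
   first factor has degree [2 t - 2]. *)
Lemma gbin_bin_dvd (p D t m j : nat) : prime p -> (1 < D)%N ->
  (D * t = p.+1)%N -> (2 * t <= ((m + j) %% p).+1)%N ->
  gbin (D%:R^-1 - 1) m * 'C(m, j)%:R * p%:R^-1 \in local_int p.
Proof.
move=> pp D1 Dt mj.
have p1 := prime_gt1 pp.
have pD : coprime p D.
  rewrite prime_coprime //; apply/negP => pD.
  have : (p %| p.+1)%N by rewrite -Dt dvdn_mulr.
  by rewrite -addn1 dvdn_addr // dvdn1 => /eqP p1'; rewrite p1' in p1.
have D0 : (D%:R : rat) != 0 by rewrite pnatr_eq0; case: (D) D1.
have p0 : (p%:R : rat) != 0 by rewrite pnatr_eq0 -lt0n prime_gt0.
have pz : D%:R^-1 - 1 \in local_int p by rewrite rpredB ?rpred1 // local_int_natV.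
have [e ze ge] := gbin_approx m pp pz.
have [mm|mm] := ltnP (m %% p) (j %% p).
  have /dvdnP[b ->] := dvdn_bin_modn_lt pp mm.
  by rewrite natrM -mulrA mulfK // rpredM ?rpred_nat // gbin_local_int.
(* Both [e + 1] and [t] are inverses of [D] modulo [p]. *)
have emod : (e.+1 = t %[mod p])%N.
  have : (p%:Z %| D%:Z * e.+1%:Z - 1)%Z.
    apply: local_int_divp => //.
    have -> : (D%:Z * e.+1%:Z - 1)%:~R / p%:R =
       - D%:R * ((D%:R^-1 - 1 - e%:R) / p%:R) :> rat.
      rewrite intrB intrM -!pmulrn -[e.+1%:R]natr1; field.
      by rewrite p0 D0.
    by rewrite rpredM // rpredN rpred_nat.
  rewrite -eqz_mod_dvd => De.
  have : (p%:Z %| D%:Z * (e.+1%:Z - t%:Z))%Z.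
    rewrite mulrBr -PoszM -[X in _ - X]PoszM Dt -eqz_mod_dvd.
    by rewrite (eqP De) -addn1 PoszD -modzDml modzz add0r.
  rewrite Gauss_dvdzr; last by rewrite coprimezE.
  by rewrite -eqz_mod_dvd !modz_nat => /eqP [].
have t0 : (0 < t)%N by case: (t) Dt; rewrite ?muln0.
have t2 : (2 * t <= p.+1)%N by rewrite -Dt leq_mul2r D1 orbT.
have tp : (t <= p)%N by move: t2 p1 {Dt pp e ze ge mj mm emod pD p0 pz}; lia.
have e_mod : (e %% p = t.-1)%N.
  have : (e = t.-1 %[mod p])%N.
    by apply/eqP; rewrite -(eqn_modDr 1) !addn1 prednK // emod.
  by rewrite [RHS]modn_small // prednK.
(* Here the residue of [j] is at most that of [m]. Were the latter at most [t - 1], the two would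
   add up to at most [2t - 2 < p], against [mj]. So it exceeds [t - 1], the residue of [e]. *)
have pC : (p %| 'C(e, m) * 'C(m, j))%N.
  apply: dvdn_mulr; apply: dvdn_bin_modn_lt => //; rewrite e_mod ltnNge.
  apply/negP => mt; move: mj mt mm; rewrite -modnDm.
  move: (m %% p)%N (j %% p)%N => m0 j0 mj mt jm.
  by move: mj; rewrite modn_small; lia.
have -> : gbin (D%:R^-1 - 1) m * 'C(m, j)%:R * p%:R^-1 =
  (gbin (D%:R^-1 - 1) m - 'C(e, m)%:R) / p%:R * 'C(m, j)%:R
  + ('C(e, m) * 'C(m, j))%:R / p%:R by rewrite natrM; ring.
rewrite rpredD ?(rpredM ge) ?rpred_nat //.
by have /dvdnP[b ->] := pC; rewrite natrM mulfK // rpred_nat.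
Qed.

Lemma half_le_uphalfD (n k : nat) : (k <= n)%N ->
  ((n.+1)./2 <= uphalf (n - k) + uphalf k)%N.
Proof. by rewrite !uphalfE -!divn2; lia. Qed.

(** The multiplier [M] is examined against each summand: either it clears [D k + 1] outright, or it
    lacks one factor [p], which is then supplied by [r (n - k)]. *)
Lemma conv_local (p D : nat) (a M : rat) (K : int) (v : nat -> rat) (n : nat) :
  prime p -> (1 < D)%N -> coprime p D -> K != 0 ->
  a \in local_int p -> v 0%N \in local_int p -> v 1%N \in local_int p ->
  M \in local_int p ->
  (forall n : nat, (1 <= n)%N ->
     (D%:R * n%:R + 1) * v n.+1 =
     K%:~R * a * n%:R * v n - K%:~R * (D%:R * n%:R - 1) * v n.-1) ->
  (forall k : nat, (k <= n)%N ->
     M / (D * k + 1)%:R \in local_int p \/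
     exists2 M', M = M' / p%:R & M' / (D * k + 1)%:R \in local_int p /\
       (forall m : nat, (m <= n - k)%N ->
         gbin (D%:R^-1 - 1) m * 'C(m, n - k - m)%:R * p%:R^-1 \in local_int p)) ->
  v n.+1 / K%:~R ^+ (n.+1)./2 * M \in local_int p.
Proof.
move=> pp D1 pD K0 pa pv0 pv1 pM vrec hM.
have Kr : (K%:~R : rat) != 0 by rewrite intr_eq0.
have pDV : D%:R^-1 \in local_int p by rewrite local_int_natV.
have pc : a / D%:R \in local_int p by rewrite rpredM.
pose U := 'X * (K%:~R *: 'X - (K%:~R * (a / D%:R))%:P) : {poly rat}.
pose r := fun i => (binpoly n.+2 (D%:R^-1 - 1) \Po U)`_i.
pose q := fun i => (binpoly n.+2 (- D%:R^-1) \Po U)`_i.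
have -> : v n.+1 = r n.+1 * v 0%N + \sum_(k < n.+1) r (n - k)%N *
    (((1 - D%:R) * v 0%N * q k.+1 + v 1%N * q k) / (D%:R * k%:R + 1)).
  by rewrite /r /q /U mulrA; exact: conv_formula D1 vrec n (ltnSn n).
have pr i : r i / K%:~R ^+ uphalf i \in local_int p.
  rewrite -[_ / _]mulr1; apply: coef_comp_binpoly_local => // m mi.
  by rewrite mulr1 rpredM ?rpred_nat ?gbin_local_int // rpredB ?rpred1.
have pq i : q i / K%:~R ^+ uphalf i \in local_int p.
  rewrite -[_ / _]mulr1; apply: coef_comp_binpoly_local => // m mi.
  by rewrite mulr1 rpredM ?rpred_nat ?gbin_local_int // rpredN.
rewrite mulrDl mulrDl rpredD //.
  rewrite [_ * v 0%N / _]mulrAC; apply: rpredM => //; apply: rpredM => //.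
  by apply: local_int_div_le K0 _ (pr _) => //; rewrite uphalf_half leq_addl.
rewrite !mulr_suml rpred_sum // => -[k kn] _ /=; rewrite ltnS in kn.
rewrite -natrM natr1 -[(D * k).+1]addn1.
set c := (1 - D%:R) * _ * _ + _.
have pq' : q k.+1 / K%:~R ^+ uphalf k \in local_int p.
  apply: (local_int_div_le K0 _ (pq k.+1)).
  by rewrite !uphalfE half_leq.
have pcK : c / K%:~R ^+ uphalf k \in local_int p.
  rewrite /c mulrDl -!mulrA; apply: rpredD; last exact: rpredM.
  apply: rpredM; first by rewrite rpredB ?rpred1 ?rpred_nat.
  exact: rpredM pv0 pq'.
pose h := (n.+1)./2; rewrite -/h.
have hle : (h <= uphalf (n - k) + uphalf k)%N.
  exact: half_le_uphalfD.
have pprod x : r (n - k)%N / K%:~R ^+ uphalf (n - k) * x \in local_int p ->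
    r (n - k)%N * c * x / K%:~R ^+ h \in local_int p.
  move=> px; apply: local_int_div_le K0 hle _.
  have -> : r (n - k)%N * c * x / K%:~R ^+ (uphalf (n - k) + uphalf k) =
    r (n - k)%N / K%:~R ^+ uphalf (n - k) * x * (c / K%:~R ^+ uphalf k).
    by rewrite exprD invfM; ring.
  by rewrite rpredM.
have -> : r (n - k)%N * (c / (D * k + 1)%:R) / K%:~R ^+ h * M =
  r (n - k)%N * c * (M / (D * k + 1)%:R) / K%:~R ^+ h by ring.
apply: pprod; have [pMk|[M' -> [pMk hk]]] := hM k kn; first by rewrite rpredM.
have -> : forall x : rat, x * (M' / p%:R / (D * k + 1)%:R) =
  x * p%:R^-1 * (M' / (D * k + 1)%:R) by move=> x; ring.
by rewrite rpredM //; apply: coef_comp_binpoly_local.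
Qed.

(** * The least common multiple and the excluded primes *)

Lemma dvdn_dD (D n k : nat) : (k <= n)%N -> (D * k + 1 %| dD D n)%N.
Proof.
(* The index [k = 0] lies outside the range of the lcm, but its factor is 1. *)
case: k => [|k] kn; first by rewrite muln0 dvd1n.
by rewrite /dD big_add1 big_mkord (biglcmn_sup (Ordinal kn)).
Qed.

Lemma frac_part_div (p m : nat) (x : rat) : 0 <= x -> x < p%:R ->
  frac_part (((p * m)%:R + x) / p%:R) = x / p%:R.
Proof.
move=> x0 xp; have p0 : (0 : rat) < p%:R by apply: le_lt_trans xp.
have xE : ((p * m)%:R + x) / p%:R = m%:R + x / p%:R.
  by rewrite natrM; field; rewrite gt_eqF.
rewrite /frac_part xE (@floor_def _ _ m%:Z); first by rewrite addrC addKr.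
rewrite intrD -[m%:Z%:~R]/(m%:R : rat) lerDl divr_ge0 ?(ltW p0) //=.
by rewrite ltrD2l ltr_pdivrMr // mul1r.
Qed.

Lemma excluded_primeP (R : realType) (D n p : nat) : excluded_prime R D n p ->
  [/\ prime p, (p <= n)%N, (p = D.-1 %[mod D])%N,
      D%:R^-1 <= frac_part ((n%:R + 1 - D%:R^-1) / p%:R)
    & frac_part ((n%:R + D%:R^-1) / p%:R) < 1 - D%:R^-1].
Proof.
by case/andP=> _ /andP[? /andP[_ /andP[? /andP[/eqP ? /and4P[_ _ ? ?]]]]].
Qed.

Lemma excluded_prime_dvd (R : realType) (D n p : nat) :
  (1 < D)%N -> excluded_prime R D n p -> (D %| p.+1)%N.
Proof.
move=> D1 /excluded_primeP[_ _ pD _ _].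
by rewrite /dvdn -addn1 -modnDml pD modnDml addn1 prednK ?modnn // ltnW.
Qed.

(** With [n0 = n mod p], both numerators lie in [[0, p)] once [n] is replaced by [n0]. Multiplying
    by [D p] and using [D t = p + 1] turns the two conditions into [t <= n0 + 1] and
    [n0 + t < p]. *)
Lemma excluded_prime_bounds (R : realType) (D n p t : nat) :
  (1 < D)%N -> (D * t = p.+1)%N -> excluded_prime R D n p ->
  (t <= (n %% p).+1)%N /\ (n %% p + t < p)%N.
Proof.
move=> D1 Dt /excluded_primeP[pp _ _ h1 h2].
have D0 : (0 : rat) < D%:R by rewrite ltr0n ltnW.
have D1r : (1 : rat) < D%:R by rewrite ltr1n.
have DV0 : (0 : rat) < D%:R^-1 by rewrite invr_gt0.
have DV1 : (D%:R^-1 : rat) < 1 by rewrite invf_lt1.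
have p0 : (0 : rat) < p%:R by rewrite ltr0n prime_gt0.
have nE : (n = p * (n %/ p) + n %% p)%N by rewrite {1}(divn_eq n p) mulnC.
have n0p : (n %% p < p)%N by rewrite ltn_pmod // prime_gt0.
move: (n %% p)%N (n %/ p)%N nE n0p => n0 n1 nE n0p.
have n0r : (n0%:R + 1 : rat) <= p%:R by rewrite natr1 ler_nat.
have n00 : (0 : rat) <= n0%:R by rewrite ler0n.
have Dtr : (D%:R * t%:R : rat) = p%:R + 1 by rewrite -natrM Dt natr1.
split.
  move: h1; rewrite nE natrD -!addrA frac_part_div; try lra.
  rewrite ler_pdivlMr // => h1.
  have h : (D%:R * t%:R : rat) <= D%:R * (n0%:R + 1).
    rewrite Dtr -[p%:R + 1]/(p%:R + 1); have := ler_wpM2l (ltW D0) h1.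
    by rewrite mulrA divff ?gt_eqF // !mulrDr mulrN divff ?gt_eqF //; lra.
  by move: h; rewrite ler_pM2l // natr1 ler_nat.
move: h2; rewrite nE natrD -!addrA frac_part_div; try lra.
rewrite ltr_pdivrMr // => h2.
have h : (D%:R * (n0%:R + t%:R) : rat) < D%:R * p%:R.
  rewrite mulrDr Dtr; have := h2; rewrite -(ltr_pM2l D0).
  by rewrite mulrA mulrBr !mulrDr divff ?gt_eqF //; lra.
by move: h; rewrite ltr_pM2l // -natrD ltr_nat.
Qed.

Lemma excluded_prod_local (R : realType) (D n p : nat) (P : pred 'I_n.+1) :
  prime p -> (forall q, P q -> val q != p) ->
  (\prod_(q < n.+1 | excluded_prime R D n q && P q) (q%:R : rat))^-1
    \in local_int p.
Proof.
move=> pp hP; rewrite -prodfV rpred_prod // => q /andP[/excluded_primeP[qp _ _ _ _] Pq].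
apply: local_int_natV; rewrite prime_coprime // dvdn_prime2 // eq_sym.
exact: hP.
Qed.

(** An excluded prime [q] has [D] dividing [q + 1], so it cannot divide [D]; the denominator is thus
    prime to [p]. *)
Lemma dD_star_local (R : realType) (D n p : nat) : prime p -> (1 < D)%N ->
  (p %| D)%N -> dD_star R D n \in local_int p.
Proof.
move=> pp D1 pD; rewrite /dD_star rpredM ?rpred_nat //.
have -> : \prod_(q < n.+1 | excluded_prime R D n q) (q%:R : rat) =
   \prod_(q < n.+1 | excluded_prime R D n q && (val q != p)) q%:R.
  apply: eq_bigl => q; case qx : (excluded_prime R D n q) => //=.
  apply/esym/negP => /eqP qp; have := excluded_prime_dvd D1 qx; rewrite qp.
  move=> /(dvdn_trans pD); rewrite -addn1 dvdn_addr // dvdn1 => /eqP p1.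
  by rewrite p1 in pp.
exact: excluded_prod_local.
Qed.

Lemma coprime_local (R : realType) (p D : nat) (a : rat) (K : int)
    (v : nat -> rat) (n : nat) :
  prime p -> (1 < D)%N -> coprime p D -> K != 0 ->
  a \in local_int p -> v 0%N \in local_int p -> v 1%N \in local_int p ->
  (forall n : nat, (1 <= n)%N ->
     (D%:R * n%:R + 1) * v n.+1 =
     K%:~R * a * n%:R * v n - K%:~R * (D%:R * n%:R - 1) * v n.-1) ->
  v n.+1 / K%:~R ^+ (n.+1)./2 * dD_star R D n \in local_int p.
Proof.
move=> pp D1 pD K0 pa pv0 pv1 vrec.
have dvdD k : (k <= n)%N -> (dD D n)%:R / (D * k + 1)%:R \in local_int p.
  move=> kn; have /dvdnP[b ->] := dvdn_dD D kn.
  by rewrite natrM mulfK ?rpred_nat // pnatr_eq0 addn1.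
have p0 : (p%:R : rat) != 0 by rewrite pnatr_eq0 -lt0n prime_gt0.
rewrite /dD_star.
have [px|px] := boolP (excluded_prime R D n p); last first.
  rewrite mulrA; apply: rpredM.
    apply: (@conv_local p D a _ K v n pp D1 pD K0 pa pv0 pv1) => [|//|k kn].
      exact: rpred_nat.
    by left; apply: dvdD.
  have -> : \prod_(q < n.+1 | excluded_prime R D n q) (q%:R : rat) =
    \prod_(q < n.+1 | excluded_prime R D n q && (val q != p)) q%:R.
    apply: eq_bigl => q; case qx : (excluded_prime R D n q) => //=.
    by apply/esym/eqP => qp; rewrite -qp qx in px.
  exact: excluded_prod_local.
have pn : (p < n.+1)%N by have [_ ? _ _ _] := excluded_primeP px.
rewrite (bigD1 (Ordinal pn)) //= invfM [(dD D n)%:R * _]mulrA mulrA.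
apply: rpredM; last by apply: excluded_prod_local => // q; rewrite -val_eqE.
have /dvdnP[t] := excluded_prime_dvd D1 px; rewrite mulnC => /esym Dt.
have [tn nt] := excluded_prime_bounds D1 Dt px.
(* The index [p - t] is at most [n], and [D (p - t) + 1 = (D - 1) p]. *)
have pdD : (p %| dD D n)%N.
  apply: (@dvdn_trans (D * (p - t) + 1)); last by apply: dvdn_dD; lia.
  apply/dvdnP; exists (D.-1); rewrite mulnBr Dt.
  have : (p.+1 <= D * p)%N by rewrite -Dt leq_mul2l; lia.
  by rewrite -subn1 mulnBl mul1n; move: (D * p)%N => Dp; lia.
apply: (@conv_local p D a _ K v n pp D1 pD K0 pa pv0 pv1) => [|//|k kn].
  by have /dvdnP[b ->] := pdD; rewrite natrM mulfK // rpred_nat.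
have [pk|pk] := boolP (p %| D * k + 1)%N; last first.
  left; rewrite rpredM //; last by rewrite local_int_natV // prime_coprime.
  by have /dvdnP[b ->] := pdD; rewrite natrM mulfK // rpred_nat.
right; exists (dD D n)%:R => //; split=> [|m mk]; first exact: dvdD.
apply: (gbin_bin_dvd pp D1 Dt); rewrite subnKC //.
(* Now [k] is congruent to [-t], so [n - k] has residue [n mod p + t], which is at least [2t - 1]:
   the range where [r (n - k)] vanishes modulo [p]. *)
have pkt : (p %| k + t)%N.
  have : (p %| D * (k + t))%N.
    have -> : (D * (k + t) = (D * k + 1) + p)%N by rewrite mulnDr Dt addn1 addSnnS.
    by rewrite dvdn_add.
  by rewrite Gauss_dvdr.
have -> : ((n - k) %% p = n %% p + t)%N.
  rewrite -(modn_small nt) modnDml.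
  have -> : (n + t = (n - k) + (k + t))%N by rewrite addnA subnK.
  by rewrite -modnDmr (eqP pkt) addn0.
by lia.
Qed.

(** * Primes dividing D at which A/K is integral *)

(** Every [D n + 1] is a unit at [p], and each recurrence step brings a factor [K] to both terms,
    enough for one power per two steps. *)
Lemma dvd_local (p D : nat) (a : rat) (K : int) (v : nat -> rat) (n : nat) :
  prime p -> (p %| D)%N -> K != 0 ->
  a \in local_int p -> v 0%N \in local_int p -> v 1%N \in local_int p ->
  (forall n : nat, (1 <= n)%N ->
     (D%:R * n%:R + 1) * v n.+1 =
     K%:~R * a * n%:R * v n - K%:~R * (D%:R * n%:R - 1) * v n.-1) ->
  v n / K%:~R ^+ n./2 \in local_int p.
Proof.
move=> pp pD K0 pa pv0 pv1 vrec.
have Kr : (K%:~R : rat) != 0 by rewrite intr_eq0.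
elim/ltn_ind: n => -[|[|n]] IH; rewrite /= ?divr1 //.
have pDn : (D * n.+1 + 1)%:R^-1 \in local_int p.
  apply: local_int_natV; rewrite prime_coprime // dvdn_addr ?dvdn_mulr //.
  by rewrite dvdn1; apply: contraTneq pp => ->.
have Dn0 : ((D * n.+1 + 1)%:R : rat) != 0 by rewrite pnatr_eq0 addn1.
have -> : v n.+2 / K%:~R ^+ n./2.+1 = (D * n.+1 + 1)%:R^-1 *
   (a * n.+1%:R * (v n.+1 / K%:~R ^+ n./2)
    - (D%:R * n.+1%:R - 1) * (v n / K%:~R ^+ n./2)).
  apply: (mulfI Dn0); rewrite mulVKf // [LHS]mulrA natrD natrM.
  have := vrec n.+1 isT; rewrite /= => ->.
  by rewrite exprS; field; rewrite Kr expf_neq0.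
apply: rpredM => //; apply: rpredB; apply: rpredM.
- by rewrite rpredM ?rpred_nat.
- by apply: local_int_div_le K0 _ (IH n.+1 _) => //; rewrite half_leq.
- by rewrite rpredB ?rpredM ?rpred_nat ?rpred1.
- by apply: IH.
Qed.

(** * Expansion in powers of x / (1 + K x^2) *)

(* The coefficient of [x^i] in [(x / (1 + K x^2))^m]. *)
Definition tau (K : rat) (m i : nat) : rat :=
  if (m <= i)%N && ~~ odd (i - m)
  then (- K) ^+ (i - m)./2 * 'C((m + (i - m)./2).-1, (i - m)./2)%:R else 0.

(** Binomial series of [(1 + K x^2)^(-m)]; for [m = 0] the truncated predecessor rightly leaves only
    [l = 0]. *)
Lemma tau_add (K : rat) (m l : nat) :
  tau K m (m + l.*2) = (- K) ^+ l * 'C((m + l).-1, l)%:R.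
Proof. by rewrite /tau leq_addr addKn odd_double doubleK. Qed.

Lemma tau_id (K : rat) (m : nat) : tau K m m = 1.
Proof. by have := tau_add K m 0; rewrite !addn0 bin0 mul1r. Qed.

Lemma tau_small (K : rat) (m i : nat) : (i < m)%N -> tau K m i = 0.
Proof. by rewrite /tau ltnNge => /negPf ->. Qed.

Lemma tau_odd (K : rat) (m i : nat) : odd (i + m) -> tau K m i = 0.
Proof. by rewrite /tau; case: leqP => //= mi; rewrite oddB // oddD => ->. Qed.

Lemma tau_spec (m i : nat) :
  (exists l, i = m + l.*2)%N \/ (i < m)%N \/ odd (i + m).
Proof.
have [im|mi] := ltnP i m; first by right; left.
have [oi|ei] := boolP (odd (i + m)); first by right; right.
left; exists (i - m)./2; rewrite even_halfK ?subnKC //.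
by rewrite oddB // -oddD.
Qed.

(* Coefficient form of [(1 + K x^2) x T_m' = m (1 - K x^2) T_m], where
   [T_m = (x / (1 + K x^2))^m]. *)
Lemma tau_deriv (K : rat) (m n : nat) :
  n.+2%:R * tau K m n.+2 + K * (n%:R * tau K m n) =
  m%:R * (tau K m n.+2 - K * tau K m n).
Proof.
have [[[|l] nE]|[nm|om]] := tau_spec m n.+2.
- rewrite addn0 in nE; rewrite -nE [tau _ _ n]tau_small //; ring.
- have nE' : n = (m + l.*2)%N by lia.
  rewrite nE nE' !tau_add.
  have := mul_bin_diag (m + l) l; rewrite addnS /= => /(congr1 (fun x => x%:R : rat)).
  rewrite !natrM !natrD -[l.+1%:R]natr1 => e.
  rewrite exprS -!muln2 !natrM -[l.+1%:R]natr1.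
  set C1 := 'C(m + l, l.+1)%:R in e *; set C0 := 'C((m + l).-1, l)%:R in e *.
  apply: subr0_eq.
  transitivity (- (2 * K * (- K) ^+ l) * ((l%:R + 1) * C1 - (m%:R + l%:R) * C0)).
    by ring.
  by rewrite e subrr mulr0.
- by rewrite (tau_small K nm) (@tau_small K m n); [ring | lia].
- by rewrite !tau_odd //; [ring | move: om; rewrite !addSn /= negbK].
Qed.

(* Coefficient form of [x^2 T_m' = m (1 - K x^2) T_(m+1)]. *)
Lemma tau_shift (K : rat) (m n : nat) :
  n.+1%:R * tau K m n.+1 = m%:R * (tau K m.+1 n.+2 - K * tau K m.+1 n).
Proof.
have [[[|l] nE]|[nm|om]] := tau_spec m n.+1.
- rewrite addn0 in nE; rewrite -nE !tau_id [tau _ _ n]tau_small //; ring.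
- have nE' : n = (m.+1 + l.*2)%N by lia.
  have nE2 : n.+2 = (m.+1 + l.+1.*2)%N by lia.
  have -> : tau K m n.+1 = (- K) ^+ l.+1 * 'C(m + l, l.+1)%:R.
    by rewrite nE tau_add addnS.
  have -> : tau K m.+1 n.+2 = (- K) ^+ l.+1 * ('C(m + l, l.+1) + 'C(m + l, l))%:R.
    by rewrite nE2 tau_add addSn /= addnS binS.
  have -> : tau K m.+1 n = (- K) ^+ l * 'C(m + l, l)%:R by rewrite nE' tau_add.
  rewrite nE.
  have := mul_bin_left (m + l) l; rewrite addnK => /(congr1 (fun x => x%:R : rat)).
  rewrite !natrM -[l.+1%:R]natr1 => e.
  rewrite exprS -!muln2 !natrD !natrM -[l.+1%:R]natr1 /=.
  set C1 := 'C(m + l, l.+1)%:R in e *; set C0 := 'C((m + l), l)%:R in e *.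
  apply: subr0_eq.
  transitivity (- (2 * K * (- K) ^+ l) * ((l%:R + 1) * C1 - m%:R * C0)).
    by ring.
  by rewrite e subrr mulr0.
- by rewrite (tau_small K nm) (@tau_small K m.+1 n.+2) ?(@tau_small K m.+1 n);
    [ring | lia | lia].
- rewrite !tau_odd; [ring| | |by []].
    by move: om; rewrite addnS addSn.
  by move: om; rewrite !addSn addnS /= negbK.
Qed.

Definition rising_ratio (D k s : nat) : rat :=
  \prod_(j < s) ((k + j)%:R / (D * (k + j) + 1)%:R).

(** The coefficient of [x^n] in the series that starts with [T^k], cut after [M] terms. *)
Definition tau_sum (D : nat) (A K : rat) (M k n : nat) : rat :=
  \sum_(s < M) A ^+ s * rising_ratio D k s * tau K (k + s) n.

(** Telescoping: the part of the recurrence without [A] sends [T^m] to a multiple of [b m], the part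
    with [A] to a multiple of [b (m+1)]. The rising ratios make consecutive terms cancel, leaving
    the two ends. *)
Lemma tau_sum_rec (D : nat) (A K : rat) (M k n : nat) :
  let b := fun m => tau K m n.+2 - K * tau K m n in
  (D%:R * n.+1%:R + 1) * tau_sum D A K M k n.+2
    - A * n.+1%:R * tau_sum D A K M k n.+1
    + K * (D%:R * n.+1%:R - 1) * tau_sum D A K M k n =
  (D%:R * k%:R - D%:R + 1) * b k
    - A ^+ M * rising_ratio D k M * (D%:R * (k + M)%:R - D%:R + 1) * b (k + M)%N.
Proof.
move=> b; rewrite /tau_sum; elim: M => [|M IHM].
  by rewrite !big_ord0 /rising_ratio big_ord0 addn0; ring.
rewrite !big_ord_recr /=.
set X := \sum_(i < M) _ in IHM *; set Y := \sum_(i < M) _ in IHM *.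
set Z := \sum_(i < M) _ in IHM *.
have W : rising_ratio D k M.+1 * (D%:R * (k + M.+1)%:R - D%:R + 1) =
    rising_ratio D k M * (k + M)%:R.
  rewrite /rising_ratio big_ord_recr /= [(k + M.+1)%N]addnS.
  set P := \prod_(i < M) _; move: (k + M)%N => m.
  rewrite -[m.+1%:R]natr1 natrD natrM.
  by field; rewrite -natrM natr1 pnatr_eq0.
set m := (k + M)%N in IHM W *.
have d := tau_deriv K m n; have h := tau_shift K m n.
have dD : (D%:R * n.+1%:R + 1) * tau K m n.+2
    + K * (D%:R * n.+1%:R - 1) * tau K m n = (D%:R * m%:R - D%:R + 1) * b m.
  rewrite -[n.+2%:R]natr1 -[n.+1%:R]natr1 in d *.
  apply: subr0_eq; rewrite /b.
  transitivity (D%:R * ((n%:R + 1 + 1) * tau K m n.+2 + K * (n%:R * tau K m n)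
    - m%:R * (tau K m n.+2 - K * tau K m n))); first by ring.
  by rewrite d subrr mulr0.
rewrite -[A ^+ M.+1 * rising_ratio D k M.+1 * _]mulrA W addnS -/m.
set r := rising_ratio D k M in IHM W *.
transitivity ((D%:R * n.+1%:R + 1) * X - A * n.+1%:R * Y + K * (D%:R * n.+1%:R - 1) * Z
  + A ^+ M * r * ((D%:R * n.+1%:R + 1) * tau K m n.+2
    + K * (D%:R * n.+1%:R - 1) * tau K m n) - A * (A ^+ M * r) * (n.+1%:R * tau K m n.+1)).
  by ring.
by rewrite IHM dD h exprS -/(b m.+1); ring.
Qed.

(** A nonzero value occurs only at [i = k + 2l], where it is an integer times [K^l], matching the
    growth of the exponent from [k./2] to [i./2]. *)
Lemma tau_mul_local (p : nat) (K : int) (x : rat) (k i : nat) : K != 0 ->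
  x / K%:~R ^+ k./2 \in local_int p ->
  x * tau K%:~R k i / K%:~R ^+ i./2 \in local_int p.
Proof.
move=> K0 px; have Kr : (K%:~R : rat) != 0 by rewrite intr_eq0.
have [[l ->]|[ik|ok]] := tau_spec k i; last 2 first.
- by rewrite tau_small // mulr0 mul0r rpred0.
- by rewrite tau_odd // mulr0 mul0r rpred0.
rewrite tau_add halfD odd_double andbF add0n doubleK exprD exprNn.
set C := 'C(_, _)%:R.
have -> : x * ((-1) ^+ l * K%:~R ^+ l * C) / (K%:~R ^+ k./2 * K%:~R ^+ l) =
  x / K%:~R ^+ k./2 * ((-1) ^+ l * C) by field; rewrite !expf_neq0.
apply: rpredM => //; rewrite rpredM ?rpred_nat //.
by rewrite rpredX // rpredN rpred1.
Qed.

(* The numbers [a k] of the expansion for [A = 0], up to index [N + 1]. *)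
Lemma tau_coefs (p D : nat) (K : int) (v0 v1 : rat) (N : nat) :
  prime p -> (p %| D)%N -> K != 0 ->
  v0 \in local_int p -> v1 \in local_int p ->
  exists a : nat -> rat,
    [/\ a 0%N = v0, a 1%N = v1,
        forall k, a k / K%:~R ^+ k./2 \in local_int p
      & forall n, (n < N)%N ->
          \sum_(k < n.+3) a k * (D%:R * k%:R - D%:R + 1) *
            (tau K%:~R k n.+2 - K%:~R * tau K%:~R k n) = 0].
Proof.
move=> pp pD K0 pv0 pv1; have Kr : (K%:~R : rat) != 0 by rewrite intr_eq0.
elim: N => [|N [a [a0 a1 pa ha]]].
  exists (fun k => if k is k'.+1 then if k' is 0 then v1 else 0 else v0).
  split=> // -[|[|k]]; rewrite /= ?divr1 //.
  by rewrite mul0r rpred0.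
pose b k n : rat := tau K%:~R k n.+2 - K%:~R * tau K%:~R k n.
pose e k : rat := D%:R * k%:R - D%:R + 1.
(* In the equation for [n = N] the new unknown has coefficient [D(N+1) + 1], a unit at [p]; earlier
   equations do not involve it. *)
pose x := - (D * N.+1 + 1)%:R^-1 * \sum_(k < N.+2) a k * e k * b k N.
exists (fun k => if k == N.+2 then x else a k); split=> // [k|n].
  case: eqP => // ->; rewrite /x -mulrA; apply: rpredM.
    rewrite rpredN local_int_natV // prime_coprime // dvdn_addr ?dvdn_mulr //.
    by rewrite dvdn1; apply: contraTneq pp => ->.
  rewrite mulr_suml rpred_sum // => j _.
  have -> : a j * e j * b j N / K%:~R ^+ N.+2./2 =
      e j * (a j * tau K%:~R j N.+2 / K%:~R ^+ N.+2./2
             - a j * tau K%:~R j N / K%:~R ^+ N./2).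
    by rewrite /b /= exprS; field; rewrite Kr expf_neq0.
  apply: rpredM; first by rewrite rpredD ?rpredB ?rpredM ?rpred_nat ?rpred1.
  by apply: rpredB; apply: tau_mul_local.
rewrite ltnS leq_eqVlt => /orP[/eqP ->|nN].
  rewrite big_ord_recr /= eqxx [tau _ _ N]tau_small // tau_id mulr0 subr0 mulr1.
  under eq_bigr => i _ do rewrite ltn_eqF //.
  rewrite /x -[N.+2%:R]natr1 -/(e _).
  set S := \sum_(i < _) _.
  have -> : D%:R * (N.+1%:R + 1) - D%:R + 1 = (D * N.+1 + 1)%:R :> rat.
    by rewrite natrD natrM; ring.
  by rewrite mulNr mulNr mulrAC mulVf ?mul1r ?subrr // pnatr_eq0 addn1.
rewrite -[RHS](ha n nN); apply: eq_bigr => i _.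
by rewrite ltn_eqF // (leq_trans (ltn_ord i)).
Qed.

(** Both sides satisfy the same recurrence and initial values; the cut at [N+2] terms is invisible
    in degrees up to [N+1]. *)
Lemma tau_formula (D : nat) (A K : rat) (v a : nat -> rat) (N : nat) :
  (forall n : nat, (1 <= n)%N ->
     (D%:R * n%:R + 1) * v n.+1 =
     A * n%:R * v n - K * (D%:R * n%:R - 1) * v n.-1) ->
  a 0%N = v 0%N -> a 1%N = v 1%N ->
  (forall n, (n < N)%N ->
      \sum_(k < n.+3) a k * (D%:R * k%:R - D%:R + 1) *
        (tau K k n.+2 - K * tau K k n) = 0) ->
  forall n, (n <= N.+1)%N -> v n = \sum_(k < N.+2) a k * tau_sum D A K N.+2 k n.
Proof.
move=> vrec a0 a1 ha; elim/ltn_ind => -[|[|n]] IH nN.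
- rewrite big_ord_recl /= {1}/tau_sum big_ord_recl /= tau_id /rising_ratio big_ord0.
  rewrite !mulr1 big1 ?addr0 => [|i _]; last by rewrite tau_small ?mulr0.
  by rewrite mulr1 a0 big1 ?addr0 // => i _; rewrite /tau_sum big1 ?mulr0 // => j _;
     rewrite tau_small ?mulr0.
- rewrite !big_ord_recl /= {1}/tau_sum big1 => [|s _]; last first.
    case: s => -[|[|s]] sN /=.
    + by rewrite /tau /= mulr0.
    (* The pair [k = 0], [s = 1] reaches degree 1, but its ratio has numerator 0. *)
    + by rewrite /rising_ratio big_ord_recl mul0r mul0r mulr0 mul0r.
    + by rewrite tau_small ?mulr0.
  rewrite mulr0 add0r {1}/tau_sum big_ord_recl /= tau_id /rising_ratio big_ord0.
  rewrite !mulr1 big1 ?addr0 => [|i _]; last by rewrite tau_small ?mulr0.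
  rewrite mulr1 a1 big1 ?addr0 // => i _; rewrite /tau_sum big1 ?mulr0 // => j _.
  by rewrite tau_small ?mulr0.
have den0 : (D%:R * n.+1%:R + 1 : rat) != 0 by rewrite -natrM natr1 pnatr_eq0.
apply: (mulfI den0); have := vrec n.+1 isT; rewrite /= => ->.
rewrite (IH n.+1) ?(IH n) ?(ltnW nN) ?(ltnW (ltnW nN)) //.
apply/eqP; rewrite eq_sym -subr_eq0; apply/eqP.
rewrite !mulr_sumr -!sumrB.
rewrite -[RHS](ha n) //.
rewrite (big_ord_widen_cond N.+2 xpredT (fun k => a k * (D%:R * k%:R - D%:R + 1) *
  (tau K k n.+2 - K * tau K k n))) //.
rewrite [RHS]big_mkcond /=; apply: eq_bigr => k _.
have := tau_sum_rec D A K N.+2 k n.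
rewrite /= [tau K (k + N.+2) n.+2]tau_small; last by lia.
rewrite [tau K (k + N.+2) n]tau_small; last by lia.
rewrite mulr0 subr0 mulr0 subr0 => e.
transitivity (a k * ((D%:R * k%:R - D%:R + 1) * (tau K k n.+2 - K * tau K k n))).
  by rewrite -e; ring.
case: ltnP => kn; first by ring.
by rewrite !tau_small //; [ring | lia].
Qed.

Lemma prod_rising (k s : nat) :
  (\prod_(j < s) (k + j) = s`! * 'C((k + s).-1, s))%N.
Proof.
elim: s => [|s IHs]; first by rewrite big_ord0 bin0.
rewrite big_ord_recr /= IHs addnS /= factS [(s.+1 * _)%N]mulnC -!mulnA; congr (_ * _)%N.
by rewrite mulnC mul_bin_diag.
Qed.

(** In [A^s = K^s a^s], the part [K^(uphalf s)] lifts the coefficient of [T^k] to the level of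
    [T^(k+s)]; the remaining [K^(s./2)] and the factorial from the rising ratio must pay for the
    denominator of [a^s], which is hypothesis [he]. *)
Lemma tau_local (p D : nat) (a : rat) (K : int) (v : nat -> rat) (n e : nat) :
  prime p -> (p %| D)%N -> K != 0 ->
  v 0%N \in local_int p -> v 1%N \in local_int p ->
  (forall n : nat, (1 <= n)%N ->
     (D%:R * n%:R + 1) * v n.+1 =
     K%:~R * a * n%:R * v n - K%:~R * (D%:R * n%:R - 1) * v n.-1) ->
  (forall s : nat, (s <= n)%N ->
     p%:R ^+ e * s`!%:R * a ^+ s * K%:~R ^+ s./2 \in local_int p) ->
  p%:R ^+ e * (v n / K%:~R ^+ n./2) \in local_int p.
Proof.
move=> pp pD K0 pv0 pv1 vrec he.
have Kr : (K%:~R : rat) != 0 by rewrite intr_eq0.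
have [c [c0 c1 pc hc]] := tau_coefs n pp pD K0 pv0 pv1.
rewrite (tau_formula vrec c0 c1 hc) ?leqnSn //.
rewrite mulr_suml mulr_sumr rpred_sum // => k _.
rewrite /tau_sum mulr_sumr mulr_suml mulr_sumr rpred_sum // => s _.
have [ns|sn] := ltnP n (k + s).
  by rewrite tau_small // !(mulr0, mul0r) rpred0.
have -> : rising_ratio D k s = s`!%:R * ('C((k + s).-1, s)%:R
    * \prod_(j < s) (D * (k + j) + 1)%:R^-1).
  by rewrite mulrA -natrM -prod_rising natr_prod /rising_ratio big_split.
set P := \prod_(j < s) _; set C := 'C(_, _)%:R.
have pP : P \in local_int p.
  rewrite rpred_prod // => j _; rewrite local_int_natV // prime_coprime //.
  rewrite dvdn_addr ?dvdn_mulr // dvdn1.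
  by apply: contraTneq pp => ->.
have pt : c k * K%:~R ^+ uphalf s * tau K%:~R (k + s) n / K%:~R ^+ n./2 \in local_int p.
  apply: tau_mul_local => //; have := pc k.
  have ks : ((k + s)./2 <= k./2 + uphalf s)%N by rewrite uphalfE -!divn2; lia.
  move=> pck; apply: local_int_div_le K0 ks _; rewrite exprD.
  have -> : c k * K%:~R ^+ uphalf s / (K%:~R ^+ k./2 * K%:~R ^+ uphalf s) =
    c k / K%:~R ^+ k./2 by field; rewrite !expf_neq0.
  by [].
have -> : p%:R ^+ e * (c k * ((K%:~R * a) ^+ s * (s`!%:R * (C * P))
    * tau K%:~R (k + s) n) / K%:~R ^+ n./2) =
  p%:R ^+ e * s`!%:R * a ^+ s * K%:~R ^+ s./2 * C * P *
  (c k * K%:~R ^+ uphalf s * tau K%:~R (k + s) n / K%:~R ^+ n./2).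
  rewrite exprMn -{1}(odd_double_half s) -addnn uphalf_half !exprD.
  by ring.
apply: rpredM => //; apply: rpredM => //; apply: rpredM; last exact: rpred_nat.
by apply: he; apply: leq_trans sn; rewrite leq_addl.
Qed.

(** * Logarithmic bounds and conclusion *)

Lemma leq_fact_dvd (m n : nat) : (m <= n)%N -> (m`! %| n`!)%N.
Proof.
by move=> /subnK <-; elim: (n - m)%N => [|k IHk] //; rewrite addSn factS dvdn_mull.
Qed.

Lemma dvdn_fact_mul (p q : nat) : (0 < p)%N -> (p ^ q * q`! %| (p * q)`!)%N.
Proof.
case: p => // p _; elim: q => [|q IHq]; first by rewrite muln0.
rewrite mulnS addSn factS expnS factS.
have -> : (p.+1 * p.+1 ^ q * (q.+1 * q`!) = (p.+1 * q.+1) * (p.+1 ^ q * q`!))%N by ring.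
rewrite [(p + p.+1 * q).+1](_ : _ = p.+1 * q.+1)%N ?dvdn_mul //; last by rewrite mulnS.
by apply: dvdn_trans IHq _; apply: leq_fact_dvd; rewrite leq_addl.
Qed.

(* Legendre's formula, with the digit sum bounded by [p - 1] times the number
   of digits. *)
Lemma leq_logn_fact (p s : nat) : prime p ->
  (s <= p.-1 * (logn p s`! + (trunc_log 2 s).+1))%N.
Proof.
move=> pp; have p1 := prime_gt1 pp; have p0 := prime_gt0 pp.
elim/ltn_ind: s => s IHs.
have [q0|q0] := posnP (s %/ p).
  have sp : (s < p)%N by rewrite ltnNge -divn_gt0 // q0.
  apply: (@leq_trans (p.-1 * 1)); first by rewrite muln1; lia.
  by rewrite leq_mul2l addnS orbT.
have s0 : (0 < s)%N by case: (s) q0; rewrite ?div0n.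
have IHq := IHs _ (ltn_Pdiv p1 s0).
have hl : (s %/ p + logn p (s %/ p)`! <= logn p s`!)%N.
  rewrite -{1}(pfactorK (s %/ p) pp) -lognM ?expn_gt0 ?p0 ?fact_gt0 //.
  apply: dvdn_leq_log; first exact: fact_gt0.
  apply: dvdn_trans (dvdn_fact_mul _ p0) _; apply: leq_fact_dvd.
  by rewrite mulnC leq_trunc_div.
(* Removing one base-[p] digit lowers the binary logarithm by at least one, since [p >= 2]. *)
have ht : ((trunc_log 2 (s %/ p)).+1 <= trunc_log 2 s)%N.
  rewrite -trunc_log2_double //; apply: leq_trunc_log.
  rewrite -muln2 (leq_trans _ (leq_trunc_div s p)) // leq_mul2l p1 orbT //.
have hs : (s <= p * (s %/ p) + p.-1)%N.
  rewrite {1}(divn_eq s p) mulnC leq_add2l.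
  by have := ltn_pmod s p0; lia.
move: (s %/ p)%N (logn p s`!) (logn p _) (trunc_log 2 s) (trunc_log 2 _) IHq hl ht hs.
move=> q l1 l2 t1 t2 h1 h2 h3 h4; apply: (leq_trans h4).
have -> : (p * q = q + p.-1 * q)%N by rewrite -{1}(prednK p0) mulSn.
apply: (@leq_trans (p.-1 * (q + l2 + t2.+1 + 1))); last by rewrite leq_mul2l; lia.
by rewrite !mulnDr muln1; move: h1; rewrite !mulnDr; lia.
Qed.

Lemma trunc_log2_leS (n : nat) : (trunc_log 2 n.+1 <= (trunc_log 2 n).+1)%N.
Proof.
case: n => [|n]; first by rewrite trunc_log1.
by rewrite -trunc_log2_double // leq_trunc_log // -addnn; lia.
Qed.

(** Put [h = s./2]. The bound on [K] leaves a deficit of [(4 - p) h] for even [s], at most [s/(p-1)]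
    for [p] equal to 2 or 3, and Legendre's bound covers this up to a logarithm. An odd [s] costs
    one more [logn p g]. *)
Lemma fact_pow_local (p g s e : nat) (a : rat) (K : int) :
  p \in [:: 2; 3]%N -> K != 0 -> (0 < g)%N -> g%:R * a \is a Num.int ->
  (2 * logn p g <= logn p `|K| + (4 - p))%N ->
  (logn p g + (trunc_log 2 s).+1 <= e)%N ->
  p%:R ^+ e * s`!%:R * a ^+ s * K%:~R ^+ s./2
    \in local_int p.
Proof.
move=> p23 K0 g0 ga hK he.
have pp : prime p by move: p23; rewrite !inE => /orP[] /eqP ->.
have p0 := prime_gt0 pp.
have pr : (p%:R : rat) != 0 by rewrite pnatr_eq0 -lt0n.
set c := logn p g in hK he *.
have pa : p%:R ^+ c * a \in local_int p.
  have [g' pg' gE] := pfactor_coprime pp g0.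
  apply/local_intP; exists g' => //.
  by rewrite mulrA -natrX -natrM -gE.
have /dvdnP[b bE] : (p ^ (c * s) %| p ^ e * s`! * `|K| ^ s./2)%N.
  have K0' : (0 < `|K|)%N by rewrite absz_gt0.
  rewrite pfactor_dvdn // ?muln_gt0 ?expn_gt0 ?p0 ?fact_gt0 ?K0' //.
  rewrite !lognM ?muln_gt0 ?expn_gt0 ?p0 ?fact_gt0 ?K0' // pfactorK // lognX.
  have hf := leq_logn_fact s pp.
  have hse : (s = odd s + s./2 + s./2)%N by rewrite -{1}(odd_double_half s) -addnn addnA.
  have hodd : (odd s <= 1)%N by case: (odd s).
  move: hse hodd hf he hK.
  move: (logn p s`!) (trunc_log 2 s) (logn p `|K|) (s./2) (nat_of_bool (odd s)).
  move: c p23 {pa} => c p23 l t k h o -> o1.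
  have hk x : (2 * c <= k + x -> 2 * c * h <= h * k + x * h)%N.
    by move=> /(leq_mul (leqnn h)); rewrite mulnDr; lia.
  have oc : (c * o <= c)%N by rewrite -{2}[c]muln1 leq_mul2l o1 orbT.
  move: p23; rewrite !inE => /orP[] /eqP -> /=; rewrite ?mul1n => h1 h2 /hk h3;
    by rewrite !mulnDr; lia.
have KE : (K%:~R : rat) = (-1) ^+ (K < 0)%R * `|K|%N%:R.
  by rewrite natr_absz {1}[K]intEsign intrM rmorphXn rmorphN1.
have -> : p%:R ^+ e * s`!%:R * a ^+ s * K%:~R ^+ s./2 =
   (p%:R ^+ c * a) ^+ s * (b%:R * ((-1) ^+ (K < 0)%R) ^+ s./2).
  rewrite KE; set sg := (- 1) ^+ _.
  rewrite [(sg * _) ^+ _]exprMn [(p%:R ^+ c * a) ^+ s]exprMn -[p%:R ^+ c ^+ s]exprM.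
  have bE' : p%:R ^+ e * s`!%:R * `|K|%N%:R ^+ s./2 = b%:R * p%:R ^+ (c * s) :> rat.
    by rewrite -!natrX -!natrM bE.
  transitivity (p%:R ^+ e * s`!%:R * `|K|%N%:R ^+ s./2 * a ^+ s * sg ^+ s./2); first by ring.
  by rewrite bE'; ring.
apply: rpredM; first exact: rpredX.
by apply: rpredM; rewrite ?rpred_nat // !rpredX // rpredN rpred1.
Qed.

Lemma trunc_log2_bigO (R : realType) (c : nat) :
  (fun n : nat => (c + (trunc_log 2 n).+2)%:R : R) =O_\oo
  (fun n : nat => ln n%:R : R).
Proof.
have ln2 : (0 : R) < ln 2 by rewrite ln_gt0 // ltr1n.
(* For [t = trunc_log 2 n >= 1] one has [c + t + 2 <= (c + 3) t], and [t ln 2 <= ln n]. *)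
apply/eqO_exP; exists ((c + 3)%:R / ln 2); first by rewrite divr_gt0 // ltr0n addnS.
exists 2%N => // n /= n2.
have n0 : (0 < n)%N by apply: leq_trans n2.
have t1 : (0 < trunc_log 2 n)%N by rewrite trunc_log_gt0.
have lnn : (trunc_log 2 n)%:R * ln 2 <= ln n%:R :> R.
  rewrite mulr_natl -lnXn ?ltr0n // ler_ln ?posrE ?ltr0n ?exprn_gt0 ?ltr0n //.
  by rewrite -natrX ler_nat trunc_logP.
rewrite ger0_norm ?ler0n // ger0_norm; last by apply: le_trans lnn; rewrite mulr_ge0 // ltW.
apply: (@le_trans _ _ ((c + 3)%:R * (trunc_log 2 n)%:R)).
  by rewrite -natrM ler_nat; nia.
by rewrite -mulrA ler_wpM2l ?ler0n // ler_pdivlMl // mulrC.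
Qed.

Lemma leq_of_lezB (k x y : nat) :
  2 * x%:Z - k%:Z <= y%:Z -> (2 * x <= y + k)%N.
Proof. by lia. Qed.

Lemma integral_with_local_factors (R : realType) (D : nat) (A : rat) (K : int)
    (v : nat -> rat)
    (hD : D \in [:: 2; 3; 4; 6]%N)
    (hK : K != 0)
    (hv0 : v 0%N \is a Num.int)
    (hv1 : v 1%N \is a Num.int)
    (hrec : forall n : nat, (1 <= n)%N ->
       (D%:R * n%:R + 1) * v n.+1 =
       A * n%:R * v n - K%:~R * (D%:R * n%:R - 1) * v n.-1)
    (g : nat) :
  g%:Z = denq (A / K%:~R) ->
  (forall p : nat, prime p -> (p %| g)%N -> (p %| D)%N) ->
  2 * (logn 2 g)%:Z - 2 <= (logn 2 `|K|%N)%:Z ->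
  (forall p : nat, prime p -> (3 <= p)%N ->
     2 * (logn p g)%:Z - 1 <= (logn p `|K|%N)%:Z) ->
  forall n : nat,
    (\prod_(p <- primes g) p%:R ^+ (logn p g + (trunc_log 2 n).+2)) *
      dD_star R D n * K%:~R ^- (n.+1 %/ 2) * v n.+1 \is a Num.int.
Proof.
move=> gE gD h2 h3 n.
have D1 : (1 < D)%N by move: hD; rewrite !inE => /or4P[] /eqP ->.
have Kr : (K%:~R : rat) != 0 by rewrite intr_eq0.
set a := A / K%:~R in gE *.
have g0 : (0 < g)%N by have := denq_gt0 a; rewrite -gE.
have ga : g%:R * a \is a Num.int.
  by rewrite -[g%:R]/(g%:Z%:~R) gE mulrC -numqE intr_int.
have vrec m : (1 <= m)%N -> (D%:R * m%:R + 1) * v m.+1 =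
    K%:~R * a * m%:R * v m - K%:~R * (D%:R * m%:R - 1) * v m.-1.
  by move=> m1; rewrite hrec // /a [K%:~R * (A / _)]mulrC divfK.
rewrite divn2.
set P := \prod_(p <- _) _.
have PE : P * dD_star R D n * K%:~R ^- (n.+1)./2 * v n.+1 =
  P * (v n.+1 / K%:~R ^+ (n.+1)./2 * dD_star R D n) by ring.
apply: int_of_local => p pp.
have pv0 := local_int_int p hv0; have pv1 := local_int_int p hv1.
have pP : P \in local_int p by rewrite rpred_prod // => q _; rewrite rpredX // rpred_nat.
have [pD|pD] := boolP (p %| D)%N; last first.
  have pcD : coprime p D by rewrite prime_coprime.
  have pa : a \in local_int p.
    rewrite unfold_in -gE prime_coprime //; apply: contra pD; exact: gD.
  rewrite PE; apply: rpredM => //.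
  exact: (coprime_local R n pp D1 pcD hK pa pv0 pv1 vrec).
have pd := dD_star_local R n pp D1 pD.
rewrite PE mulrA; apply: rpredM => //.
have [pg|pg] := boolP (p %| g)%N; last first.
  have pa : a \in local_int p by rewrite unfold_in -gE prime_coprime.
  by apply: rpredM => //; exact: (dvd_local _ pp pD hK pa pv0 pv1 vrec).
have p23 : p \in [:: 2; 3]%N.
  have : (p \in primes D) by rewrite mem_primes pp pD ltnW.
  by move: hD; rewrite !inE => /or4P[] /eqP -> /=; rewrite ?inE /=;
     do ?[case/orP]; move/eqP => ->.
have pK : (2 * logn p g <= logn p `|K| + (4 - p))%N.
  move: p23; rewrite !inE => /orP[] /eqP pE; rewrite pE.
    exact: leq_of_lezB h2.
  exact: leq_of_lezB (h3 3%N isT isT).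
have pg' : p \in primes g by rewrite mem_primes pp g0.
rewrite /P (bigD1_seq p) ?primes_uniq //= mulrAC.
apply: rpredM; last by rewrite rpred_prod // => q _; rewrite rpredX // rpred_nat.
apply: (tau_local pp pD hK pv0 pv1 vrec) => s sn.
apply: fact_pow_local p23 hK g0 ga pK _.
(* Here [s <= n + 1]: one unit of the exponent pays for passing from [n] to [n + 1], the other for
   the digit count. *)
rewrite leq_add2l ltnS; apply: leq_trans (trunc_log2_leS n).
exact: leq_trunc_log.
Qed.

Theorem theorem8p2 (R : realType) (D : nat) (A : rat) (K : int)
    (v : nat -> rat)
    (hD : D \in [:: 2; 3; 4; 6]%N)
    (hK : K != 0)
    (hv0 : v 0%N \is a Num.int)
    (hv1 : v 1%N \is a Num.int)
    (hrec : forall n : nat, (1 <= n)%N ->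
       (D%:R * n%:R + 1) * v n.+1 =
       A * n%:R * v n - K%:~R * (D%:R * n%:R - 1) * v n.-1) :
  (A / K%:~R \is a Num.int ->
     forall n : nat, (1 <= n)%N ->
       dD_star R D n * K%:~R ^- (n.+1 %/ 2) * v n.+1 \is a Num.int) /\
  (forall g : nat, g%:Z = denq (A / K%:~R) ->
     (forall p : nat, prime p -> (p %| g)%N -> (p %| D)%N) ->
     2 * (logn 2 g)%:Z - 2 <= (logn 2 `|K|%N)%:Z ->
     (forall p : nat, prime p -> (3 <= p)%N ->
        2 * (logn p g)%:Z - 1 <= (logn p `|K|%N)%:Z) ->
     exists e : nat -> nat -> nat,
       (forall p : nat, prime p -> (p %| g)%N ->
          (fun n : nat => (e p n)%:R : R) =O_\oo (fun n : nat => ln n%:R : R)) /\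
       (forall n : nat, (1 <= n)%N ->
          (\prod_(p <- primes g) p%:R ^+ e p n) *
            dD_star R D n * K%:~R ^- (n.+1 %/ 2) * v n.+1 \is a Num.int)).
Proof.
split=> [aK n _|g gE gD h2 h3].
  (* Integrality of [A/K] is the case [g = 1], where the product over primes is empty. *)
  have g1 : 1%:Z = denq (A / K%:~R) by move: aK; rewrite Qint_def => /eqP.
  have := @integral_with_local_factors R D A K v hD hK hv0 hv1 hrec 1%N g1 _ _ _ n.
  rewrite [primes 1]/= big_nil mul1r; apply=> [p pp|//|p _ _]; rewrite ?logn1 //.
  by rewrite dvdn1 => /eqP p1; rewrite p1 in pp.
exists (fun p n => logn p g + (trunc_log 2 n).+2)%N; split=> [p _ _|n _].
  exact: trunc_log2_bigO.
exact: (integral_with_local_factors R hD hK hv0 hv1 hrec gE gD h2 h3).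
Qed.
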